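(* Let $\mathfrak{P}_1$ be the set of all probability distributions $\{p_i\}_{i=0}^{+\infty}$, and let $\bar p=\{p_i\}$ and $\bar q=\{q_i\}$ be distributions in $\mathfrak{P}_1$ such that $\operatorname{supp}\bar p\subseteq\operatorname{supp}\bar q$. Put $$L_{D_{\bar q}}(\bar p|\varepsilon)=\inf\{D_{KL}(\bar r\|\bar q):\bar r\in\mathfrak{P}_1,\ \mathrm{TV}(\bar p,\bar r)\le\varepsilon\},$$ $$L^d_{D_{\bar q}}(\bar p|\varepsilon)=\inf\{D_{KL}(\bar r\|\bar q):\bar r\in\mathfrak{P}_1,\ |\bar r|\le d,\ \mathrm{TV}(\bar p,\bar r)\le\varepsilon\},$$ where $\inf\emptyset=+\infty$. Then $$L_{D_{\bar q}}(\bar p|\varepsilon)\ge\sum_{i\in I_\varepsilon}(p_i-\varepsilon)\ln\frac{p_i-\varepsilon}{c_\varepsilon q_i}-g(\varepsilon)-\tilde h_2(\varepsilon)-h_2(1-c_\varepsilon)\qquad\forall\varepsilon\in(0,1],\qquad\text{(i)}$$ where $I_\varepsilon$ is the set of all $i$ such that $p_i>\varepsilon$ and $c_\varepsilon=\sum_{i\in I_\varepsilon}(p_i-\varepsilon)$. If $H(\bar p)<+\infty$ and $d\ge2$ is a natural number then $$L^d_{D_{\bar q}}(\bar p|\varepsilon)\ge\sum_{i\in I_\varepsilon}(-\ln q_i)(p_i-\varepsilon)-H(\bar p)-\varepsilon\ln(d-1)-h_2(\varepsilon)\qquad\forall\varepsilon\in(0,1-1/d].\qquad\text{(ii)}$$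 The lower bounds (i) and (ii) are faithful: their right hand sides tend to $D_{KL}(\bar p\|\bar q)\le+\infty$ as $\varepsilon\to0$.
   Context: $\operatorname{supp}\bar p$ is the set of all $i$ with $p_i>0$, and $|\bar r|$ is the number of nonzero entries of $\bar r$. $\mathrm{TV}(\bar p,\bar r)=\frac12\sum_i|p_i-r_i|$. The Kullback–Leibler divergence is $D_{KL}(\bar p\|\bar q)=\sum_ip_i\ln(p_i/q_i)\in[0,+\infty]$ with $0\ln0=0$, and $D_{KL}(\bar p\|\bar q)=+\infty$ if $\operatorname{supp}\bar p\not\subseteq\operatorname{supp}\bar q$. The Shannon entropy is $H(\bar p)=\sum_i\eta(p_i)$, $\eta(x)=-x\ln x$ for $x>0$, $\eta(0)=0$. $h_2(p)=\eta(p)+\eta(1-p)$; $\tilde h_2(p)=h_2(p)$ for $p\in[0,\frac12]$ and $\tilde h_2(p)=\ln2$ for $p\in(\frac12,1]$; $g(x)=(x+1)\ln(x+1)-x\ln x$ for $x>0$, $g(0)=0$. A sum over the empty set is $0$. *)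

(* Defs.v *)
From HB Require Import structures.
From mathcomp Require Import all_boot all_order all_algebra.
From mathcomp Require Import all_classical all_reals all_analysis.
Set Implicit Arguments.
Unset Strict Implicit.
Unset Printing Implicit Defensive.
Import Order.TTheory GRing.Theory Num.Theory.
Import numFieldNormedType.Exports.
Local Open Scope classical_set_scope.
Local Open Scope ring_scope.

Definition supp {R : realType} (p : R^nat) : set nat := [set i | 0 < p i].

Definition P1 {R : realType} : set (R^nat) :=
  [set p | (forall i, 0 <= p i) /\ (\sum_(i <oo) (p i)%:E = 1)%E].

Definition TV {R : realType} (p r : R^nat) : \bar R :=
  ((2^-1)%:E * \sum_(i <oo) `|p i - r i|%:E)%E.

(* When supp p is included in supp q and p, q are in P1, the terms satisfy
   p i * ln (p i / q i) >= p i - q i, whose right-hand side is summable, so the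
   limit of the partial sums exists in [0, +oo] and does not depend on the
   order of summation.  Terms with p i = 0 vanish. *)
Definition KL {R : realType} (p q : R^nat) : \bar R :=
  if `[< supp p `<=` supp q >]
  then (\sum_(i <oo) (p i * ln (p i / q i))%:E)%E
  else +oo%E.

(* The product by 0 yields eta 0 = 0; likewise g 0 = 0 below. *)
Definition eta {R : realType} (x : R) : R := - (x * ln x).

Definition shannon {R : realType} (p : R^nat) : \bar R :=
  (\sum_(i <oo) (eta (p i))%:E)%E.

Definition h2 {R : realType} (x : R) : R := eta x + eta (1 - x).

Definition h2t {R : realType} (x : R) : R :=
  if x <= 2^-1 then h2 x else ln 2.

Definition g {R : realType} (x : R) : R := (x + 1) * ln (x + 1) - x * ln x.

(* ereal_inf set0 = +oo *)
Definition L_KL {R : realType} (q p : R^nat) (eps : R) : \bar R :=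
  ereal_inf [set KL r q | r in [set r | P1 r /\ (TV p r <= eps%:E)%E]].

Definition Ld_KL {R : realType} (d : nat) (q p : R^nat) (eps : R) : \bar R :=
  ereal_inf [set KL r q | r in
    [set r | [/\ P1 r, (supp r #<= `I_d)%card & (TV p r <= eps%:E)%E]]].

Definition Ieps {R : realType} (p : R^nat) (eps : R) : set nat :=
  [set i | eps < p i].

(* For p in P1 and eps > 0 the set Ieps p eps is finite, so the sums over it
   below are genuine finite sums (\sum_(i \in A) is 0 on an infinite support). *)
Definition ceps {R : realType} (p : R^nat) (eps : R) : R :=
  \sum_(i \in Ieps p eps) (p i - eps).

Definition bound_i {R : realType} (p q : R^nat) (eps : R) : R :=
  \sum_(i \in Ieps p eps)
     (p i - eps) * ln ((p i - eps) / (ceps p eps * q i))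
  - g eps - h2t eps - h2 (1 - ceps p eps).

Definition bound_ii {R : realType} (d : nat) (p q : R^nat) (eps : R) : \bar R :=
  ((\sum_(i \in Ieps p eps) (- ln (q i)) * (p i - eps))%R%:E
   - shannon p - (eps * ln (d%:R - 1))%:E - (h2 eps)%:E)%E.

(* Main.v *)
Require Import Defs.
From mathcomp Require Import all_boot all_order all_algebra.
From mathcomp Require Import all_classical all_reals all_analysis.
From mathcomp Require Import ring lra.
Import Order.TTheory GRing.Theory Num.Theory.
Import numFieldNormedType.Exports.
Local Open Scope classical_set_scope.
Local Open Scope ring_scope.

(* The TV constraint gives r_i >= s_i := max(0, p_i - eps), and s has mass c.
   Writing r = s + t and using the monotonicity of ln,
     r ln(r/q) >= s ln(s/q) + t ln(t/q) >= s ln(s/q) + t ln(1-c) + t - (1-c) q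
   termwise; summing gives (i), even without the terms g(eps) and h2t(eps).
   For (ii), D(r||q) = - H(r) + sum_i (- ln q_i) r_i, where the last sum is at least
   sum_i (- ln q_i) s_i, and H(r) <= H(p) + eps ln(d-1) + h2(eps): after moving
   the mass of p outside supp r onto one point of supp r, this is Fano's
   inequality for a maximal coupling of r and p.
   For the limits, the bounds never exceed D(p||q), while p ln(p/q) - p + q >= 0
   makes every partial sum of D(p||q) an asymptotic lower bound. *)

(** * Elementary inequalities for x ln(x/a), and the functions [eta], [h2], [h2t], [g] *)

Lemma mul_ln_ge {R : realType} (x a : R) : 0 <= x -> 0 <= a ->
  (0 < x -> 0 < a) -> x - a <= x * ln (x / a).
Proof.
move=> x0 a0 xa; have [xp|] := ltP 0 x; last first.
  by move=> xle; have -> : x = 0; [lra|rewrite mul0r; lra].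
have ap := xa xp.
have h : ln (a / x) <= a / x - 1.
  have -> : a / x = 1 + (a / x - 1) by ring.
  apply: le_trans (le_ln1Dx _) _; last by lra.
  by have : 0 < a / x; [exact: divr_gt0|lra].
have -> : ln (x / a) = - ln (a / x) by rewrite !ln_div ?posrE//; lra.
have -> : x - a = x * (1 - a / x) by field; rewrite gt_eqF.
rewrite ler_pM2l//; lra.
Qed.

Lemma mul_ln_divE {R : realType} (x a : R) : 0 <= x ->
  (0 < x -> 0 < a) -> x * ln (x / a) = - eta x - x * ln a.
Proof.
move=> x0 xa; rewrite /eta; have [xp|] := ltP 0 x.
  by rewrite ln_div ?posrE ?xa//; lra.
by move=> xle; have -> : x = 0; [lra|rewrite !mul0r; lra].
Qed.

(** Monotonicity of [ln] separates [s] from [t]; then [mul_ln_ge] at [T * a] bounds t ln(t/a) below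
    by a linear term. When [T] is the total mass of the t's and the a's sum to 1, the corrections
    [t - T * a] cancel in the sum. *)
Lemma mul_ln_split {R : realType} (s t T a : R) : 0 <= s -> 0 <= t -> 0 <= T ->
  0 <= a -> (0 < s + t -> 0 < a) -> (0 < t -> 0 < T) ->
  s * ln (s / a) + t * ln T + t - T * a <= (s + t) * ln ((s + t) / a).
Proof.
move=> s0 t0 T0 a0 sta tT.
have Ta : 0 <= T * a by exact: mulr_ge0.
have mono (x y : R) : 0 <= x -> x <= y -> (0 < y -> 0 < a) ->
    x * ln (x / a) <= x * ln (y / a).
  move=> x0 xy ya; have [xp|] := ltP 0 x; last first.
    by move=> xle; have -> : x = 0; [lra|rewrite !mul0r].
  have ap : 0 < a by apply: ya; lra.
  rewrite ler_pM2l// ler_ln ?posrE ?divr_gt0//; last lra.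
  by rewrite ler_pM2r ?invr_gt0.
have hs : s * ln (s / a) <= s * ln ((s + t) / a) by apply: mono => //; lra.
have ht : t * ln (t / a) <= t * ln ((s + t) / a) by apply: mono => //; lra.
suff : t * ln T + t - T * a <= t * ln (t / a) by lra.
have [tp|] := ltP 0 t; last first.
  by move=> tle; have -> : t = 0; [lra|rewrite !mul0r; lra].
have Tp := tT tp; have ap : 0 < a by apply: sta; lra.
have := @mul_ln_ge _ t (T * a) t0 Ta (fun=> mulr_gt0 Tp ap).
rewrite !ln_div ?posrE ?mulr_gt0// lnM ?posrE//; lra.
Qed.

Lemma eta0 {R : realType} : eta (0 : R) = 0.
Proof. by rewrite /eta mul0r oppr0. Qed.

Lemma eta1 {R : realType} : eta (1 : R) = 0.
Proof. by rewrite /eta ln1 mulr0 oppr0. Qed.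

Lemma eta_ge0 {R : realType} (x : R) : 0 <= x <= 1 -> 0 <= eta x.
Proof.
by move=> /andP[x0 x1]; rewrite /eta oppr_ge0 mulr_ge0_le0// ln_le0.
Qed.

Lemma h2_ge0 {R : realType} (x : R) : 0 <= x <= 1 -> 0 <= h2 x.
Proof. by move=> x01; rewrite /h2 addr_ge0// eta_ge0//; lra. Qed.

Lemma h2t_ge0 {R : realType} (x : R) : 0 <= x <= 1 -> 0 <= h2t x.
Proof.
by move=> x01; rewrite /h2t; case: ifP => _; [exact: h2_ge0|rewrite ln_ge0//; lra].
Qed.

Lemma g_ge0 {R : realType} (x : R) : 0 <= x <= 1 -> 0 <= g x.
Proof.
move=> x01; have := eta_ge0 x x01; rewrite /eta /g => h.
have : 0 <= (x + 1) * ln (x + 1) by rewrite mulr_ge0 ?ln_ge0//; lra.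
lra.
Qed.

(** With w = sqrt x, eta x = 2 w (w ln(1/w)), and ln(1/w) < 1/w bounds the inner factor by 1. This
    majorant gives continuity of [eta] at 0. *)
Lemma eta_le_sqrt {R : realType} (x : R) : eta x <= 2 * Num.sqrt x.
Proof.
have [xp|xle] := ltP 0 x; last first.
  by rewrite /eta ln0// mulr0 oppr0 mulr_ge0// sqrtr_ge0.
set w := Num.sqrt x; have wp : 0 < w by rewrite sqrtr_gt0.
have xw : x = w * w by rewrite -expr2 sqr_sqrtr// ltW.
have := @ln_sublinear R w^-1; rewrite invr_gt0 lnV ?posrE// => /(_ wp) h.
rewrite /eta xw lnM ?posrE//.
have -> : - (w * w * (ln w + ln w)) = 2 * (w * (w * - ln w)) by ring.
rewrite ler_pM2l//.
rewrite -[leRHS]mulr1 ler_pM2l// -[leRHS](@divff _ w) ?gt_eqF//.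
by rewrite ler_pM2l// ltW.
Qed.

(** At 0 the continuity is two-sided: [ln] is 0 on negative reals, so [eta] vanishes there, and on
    the right it lies between 0 and 2 sqrt y. *)
Lemma continuous_eta {R : realType} (x : R) : 0 <= x -> {for x, continuous eta}.
Proof.
rewrite le_eqVlt => /predU1P[<-|xp]; last first.
  by apply: cvgN; apply: cvgM; [exact: cvg_id|exact: continuous_ln].
rewrite /prop_for /continuous_at eta0.
apply: (@squeeze_cvgr _ _ _ _ (fun=> 0) (fun y => 2 * Num.sqrt y)).
- near=> y; rewrite eta_le_sqrt andbT.
  have [y0|y0] := leP 0 y; last by rewrite /eta ln0 ?mulr0 ?oppr0// ltW.
  rewrite eta_ge0// y0/= ltW//.
  near: y; apply: lt_nbhsl; lra.
- exact: cvg_cst.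
- rewrite -[X in _ --> X](mulr0 2); apply: cvgM; first exact: cvg_cst.
  rewrite -[X in _ --> X](sqrtr0 R); exact: sqrt_continuous.
Unshelve. all: by end_near. Qed.

(** * Partial sums of distributions and the total variation constraint *)

Lemma P1_cvg {R : realType} (p : R^nat) : P1 p ->
  \sum_(0 <= i < n) p i @[n --> \oo] --> (1 : R).
Proof.
move=> [p0 p1].
have : (\sum_(0 <= i < n) p i)%:E @[n --> \oo] --> (1%:E : \bar R).
  have := @is_cvg_nneseries R (fun i => (p i)%:E) xpredT 0 => /(_ _)/cvg_ex[].
    by move=> n _ _; rewrite lee_fin.
  move=> l hl; rewrite -p1 (cvg_lim _ hl)//.
  apply: cvg_trans hl; apply: near_eq_cvg; near=> n.
  by rewrite sumEFin.
by move=> /fine_cvgP[_]; apply: cvg_trans.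
Unshelve. all: by end_near. Qed.

Lemma psum_nd {R : realType} (p : R^nat) : (forall i, 0 <= p i) ->
  {homo (fun n => \sum_(0 <= i < n) p i) : m n / (m <= n)%N >-> m <= n}.
Proof.
move=> p0 m n mn; rewrite [leRHS](big_cat_nat _ mn)//= lerDl.
by apply: sumr_ge0.
Qed.

Lemma P1_psum_le1 {R : realType} (p : R^nat) n : P1 p ->
  \sum_(0 <= i < n) p i <= 1.
Proof.
move=> hp; have [p0 _] := hp.
apply: (cvgr_to_ge (P1_cvg p hp)); exists n => // m /= nm; exact: psum_nd.
Qed.

Lemma P1_le1 {R : realType} (p : R^nat) i : P1 p -> p i <= 1.
Proof.
move=> hp; apply: le_trans (P1_psum_le1 p i.+1 hp).
by rewrite big_nat_recr//= lerDr; apply: sumr_ge0 => j _; have [] := hp.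
Qed.

Lemma P1B_cvg {R : realType} (p r : R^nat) : P1 p -> P1 r ->
  \sum_(0 <= i < n) (p i - r i) @[n --> \oo] --> (0 : R).
Proof.
move=> /P1_cvg hp /P1_cvg hr.
rewrite (_ : (fun n => _) = (fun n => \sum_(0 <= i < n) p i - \sum_(0 <= i < n) r i)).
  by rewrite -[X in _ --> X](subrr (1 : R)); apply: cvgB; [exact: hp|exact: hr].
by apply/funext => n; rewrite sumrB.
Qed.

Lemma TV_sym {R : realType} (p r : R^nat) : TV p r = TV r p.
Proof. by congr (_ * _)%E; apply: eq_eseriesr => i _; rewrite distrC. Qed.

Lemma TV_psum_le {R : realType} (p r : R^nat) eps n :
  (TV p r <= eps%:E)%E -> \sum_(0 <= i < n) `|p i - r i| <= 2 * eps.
Proof.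
move=> h.
have : ((\sum_(0 <= i < n) `|p i - r i|%:E) <= (2 * eps)%:E)%E; last first.
  by rewrite sumEFin lee_fin.
apply: (@le_trans _ _ (\sum_(i <oo) `|p i - r i|%:E)%E).
  by apply: nneseries_lim_ge => i _; rewrite lee_fin.
rewrite EFinM -lee_pdivrMl//.
Qed.

(** max(0, x) = (|x| + x)/2, and the signed differences p_i - r_i sum to 0, so the total excess is
    half of the l1 distance. *)
Lemma TV_excess {R : realType} (p r : R^nat) eps n : P1 p -> P1 r ->
  (TV p r <= eps%:E)%E -> \sum_(0 <= i < n) Num.max 0 (p i - r i) <= eps.
Proof.
move=> hp hr h.
(* A finite signed sum need not vanish, so the excess up to [m] is bounded by [eps] plus an error
   tending to 0, and [m] goes to infinity. *)
have hc : eps + 2^-1 * \sum_(0 <= i < n) (p i - r i) @[n --> \oo] --> eps.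
  rewrite -[X in _ --> X]addr0 -[X in _ + X](mulr0 2^-1).
  by apply: cvgD; [exact: cvg_cst|apply: cvgM; [exact: cvg_cst|exact: P1B_cvg]].
apply: (cvgr_to_ge hc); exists n => // m /= nm.
apply: (@le_trans _ _ (\sum_(0 <= i < m) Num.max 0 (p i - r i))).
  by apply: psum_nd => // i; rewrite le_max lexx.
have -> : \sum_(0 <= i < m) Num.max 0 (p i - r i) =
   2^-1 * \sum_(0 <= i < m) `|p i - r i| + 2^-1 * \sum_(0 <= i < m) (p i - r i).
  rewrite !mulr_sumr -big_split/=; apply: eq_bigr => i _.
  by have [h0|h0] := leP 0 (p i - r i); [rewrite ger0_norm//|rewrite ltr0_norm//]; lra.
have := TV_psum_le p r eps m h; lra.
Qed.

(** One term of the excess sum is at most [eps]; bounding |p_i - r_i| by the l1 distance would only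
    give 2 eps. *)
Lemma TV_ge {R : realType} (p r : R^nat) eps i : P1 p -> P1 r ->
  (TV p r <= eps%:E)%E -> p i - eps <= r i.
Proof.
move=> hp hr h; have := TV_excess p r eps i.+1 hp hr h.
rewrite big_nat_recr//=.
have : 0 <= \sum_(0 <= j < i) Num.max 0 (p j - r j).
  by apply: sumr_ge0 => j _; rewrite le_max lexx.
have : p i - r i <= Num.max 0 (p i - r i) by rewrite le_max lexx orbT.
lra.
Qed.

(** * The divergence as a limit of real partial sums *)

Lemma KL_cvg {R : realType} (p q : R^nat) : P1 p -> P1 q -> supp p `<=` supp q ->
  (\sum_(0 <= i < n) p i * ln (p i / q i))%:E @[n --> \oo] --> KL p q.
Proof.
move=> hp hq hpq; have [p0 _] := hp; have [q0 _] := hq.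
(* The terms of the divergence have no fixed sign. Subtracting p_i - q_i makes them nonnegative,
   hence the partial sums monotone, and the subtracted sums tend to 0. *)
pose f i := p i * ln (p i / q i) - (p i - q i).
have f0 i : 0 <= f i by rewrite subr_ge0; apply: mul_ln_ge => // /hpq.
have [l hl] : exists l, (\sum_(0 <= i < n) f i)%:E @[n --> \oo] --> (l : \bar R).
  by eexists; apply: ereal_nondecreasing_cvgn => m n mn; rewrite lee_fin psum_nd.
have hD : (\sum_(0 <= i < n) p i * ln (p i / q i))%:E @[n --> \oo] --> l.
  rewrite -[X in _ --> X]adde0.
  have h0 : (\sum_(0 <= i < n) (p i - q i))%:E @[n --> \oo] --> (0%:E : \bar R).
    by apply: cvg_EFin; [exact: nearW|exact: P1B_cvg].
  have := @cvgeD _ _ _ _ _ _ _ _ _ hl h0.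
  rewrite fin_num_adde_defl// => /(_ _ isT) hc.
  apply: cvg_trans hc; apply: near_eq_cvg; near=> n.
  by rewrite -EFinD -big_split/=; congr (_%:E); apply: eq_bigr => i _; rewrite subrK.
rewrite /KL asboolT//; suff -> : (\sum_(i <oo) (p i * ln (p i / q i))%:E)%E = l by [].
apply: cvg_lim => //; apply: cvg_trans hD; apply: near_eq_cvg; near=> n.
by rewrite sumEFin.
Unshelve. all: by end_near. Qed.

Lemma KL_ge {R : realType} (p q : R^nat) (x : R^nat) (b : R) :
  P1 p -> P1 q -> supp p `<=` supp q -> x n @[n --> \oo] --> b ->
  (\forall n \near \oo, x n <= \sum_(0 <= i < n) p i * ln (p i / q i)) ->
  (b%:E <= KL p q)%E.
Proof.
move=> hp hq hpq xb hx.
have xe : (x n)%:E @[n --> \oo] --> b%:E by apply: cvg_EFin; [exact: nearW|].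
apply: (lee_cvg_to xe (KL_cvg p q hp hq hpq)).
by apply: filterS hx => n; rewrite lee_fin.
Qed.

Lemma KL_ge0 {R : realType} (p q : R^nat) : P1 p -> P1 q -> (0 <= KL p q)%E.
Proof.
move=> hp hq; have [hpq|/asboolPn hpq] := pselect (supp p `<=` supp q); last first.
  by rewrite /KL (negbTE hpq) leey.
apply: (@KL_ge _ _ _ (fun n => \sum_(0 <= i < n) (p i - q i))) => //.
  exact: P1B_cvg.
have [p0 _] := hp; have [q0 _] := hq.
apply: nearW => n; apply: ler_sum => i _; exact: mul_ln_ge (@hpq i).
Qed.

(** * Fano-type entropy inequality on a finite set *)

Lemma mul_ln_le {R : realType} (w r a p : R) : 0 <= w <= r -> 0 < a -> 0 <= p ->
  (0 < w -> 0 < p) -> w * (ln a + ln p - ln r) <= a * p - w.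
Proof.
move=> /andP[w0 wr] a0 p0 wp; have [wpos|] := ltP 0 w; last first.
  move=> wle; have -> : w = 0 by lra.
  by rewrite mul0r subr0 mulr_ge0// ltW.
have pp := wp wpos.
(* For a coupling cell of mass [w] in a row of mass [r], this is Gibbs' inequality against the
   channel mass [a * p]; ln w <= ln r below is the cell form of H(X) <= H(X,Y). *)
have := @mul_ln_ge _ w (a * p) w0 (mulr_ge0 (ltW a0) p0) (fun=> mulr_gt0 a0 pp).
rewrite ln_div ?posrE ?mulr_gt0// lnM ?posrE//.
have : w * ln w <= w * ln r by rewrite ler_pM2l// ler_ln ?posrE//; lra.
lra.
Qed.

(* The coupling of r and p puts mass min(r x, p x) on (x, x) and u x * v y / delta
   on (x, y), with u, v the excesses of r over p and of p over r.  It is compared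
   with the channel that keeps y with probability 1 - eps and otherwise moves
   to each of the other points with probability eps / (d - 1). *)
Lemma entropy_le_TV_finite {R : realType} (T : finType) (D : pred T) (r p : T -> R)
    (d : nat) (eps : R) : (2 <= d)%N -> (#|D| <= d)%N -> 0 < eps <= 1 - d%:R^-1 ->
  (forall x, D x -> 0 < r x) -> (forall x, D x -> 0 <= p x) ->
  \sum_(x | D x) r x = 1 -> \sum_(x | D x) p x = 1 ->
  \sum_(x | D x) Num.max 0 (r x - p x) <= eps ->
  \sum_(x | D x) eta (r x) <=
    \sum_(x | D x) eta (p x) + eps * ln (d%:R - 1) + h2 eps.
Proof.
move=> d2 cardD /andP[eps0 epsd] r0 p0 sr sp.
pose u x := Num.max 0 (r x - p x); pose v x := Num.max 0 (p x - r x).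
set dlt := \sum_(x | D x) Num.max 0 (r x - p x) => dlteps.
have u0 x : 0 <= u x by rewrite le_max lexx.
have v0 x : 0 <= v x by rewrite le_max lexx.
have uv x : r x - u x = p x - v x.
  rewrite /u /v; have [h|h] := leP 0 (r x - p x); have [k|k] := leP 0 (p x - r x); lra.
have ur x : D x -> u x <= r x.
  by move=> Dx; have := r0 x Dx; have := p0 x Dx; rewrite ge_max; lra.
have vp x : D x -> v x <= p x.
  by move=> Dx; have := r0 x Dx; have := p0 x Dx; rewrite ge_max; lra.
(* The excesses have disjoint supports, so the product part of the coupling puts no mass on the
   diagonal. *)
have uvx x : u x * v x = 0.
  rewrite /u /v; have [h|h] := leP 0 (r x - p x); last by rewrite mul0r.
  by have [k|k] := leP 0 (p x - r x); [have -> : r x - p x = 0; [lra|rewrite mul0r]|rewrite mulr0].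
have su : \sum_(x | D x) u x = dlt by [].
have sv : \sum_(x | D x) v x = dlt.
  have : \sum_(x | D x) (r x - u x) = \sum_(x | D x) (p x - v x) by apply: eq_bigr.
  rewrite !sumrB sr sp su; lra.
have dlt0 : 0 <= dlt by rewrite -su; apply: sumr_ge0.
have led x (f : T -> R) : (forall x, 0 <= f x) -> D x -> f x <= \sum_(x | D x) f x.
  by move=> f0 Dx; rewrite (bigD1 x)//= lerDl sumr_ge0.
(* If [dlt = 0] the quotient is 0 by convention, but then [u] vanishes on [D] too, so the
   cancellation still holds; likewise for [v]. *)
have udlt x : D x -> u x / dlt * dlt = u x.
  move=> Dx; have [dz|dz] := eqVneq dlt 0; last by rewrite divfK.
  have := led x u u0 Dx; rewrite su dz mulr0 => h; have := u0 x; lra.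
have vdlt x : D x -> dlt * (v x / dlt) = v x.
  move=> Dx; have [dz|dz] := eqVneq dlt 0; last by rewrite mulrC divfK.
  have := led x v v0 Dx; rewrite sv dz mul0r => h; have := v0 x; lra.
have dR : 2 <= d%:R :> R by rewrite (ler_nat R 2 d).
have deps : eps <= (d%:R - 1) * (1 - eps).
  have : d%:R * eps <= d%:R * (1 - d%:R^-1) by rewrite ler_pM2l//; lra.
  rewrite mulrBr divff; last lra.
  lra.
have eps1 : 0 < 1 - eps.
  have : 0 < d%:R^-1 :> R by rewrite invr_gt0; lra.
  lra.
set b := eps / (d%:R - 1).
have b0 : 0 < b by rewrite divr_gt0//; lra.
have beps : b <= 1 - eps.
  have d10 : 0 < d%:R - 1 :> R by lra.
  by rewrite ler_pdivrMr// mulrC.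
(* [hA] sums the diagonal cells, [hB] the product part. *)
have hA : \sum_(x | D x) (r x - u x) * (ln (1 - eps) + ln (p x) - ln (r x)) <=
    \sum_(x | D x) ((1 - eps) * p x - (r x - u x)).
  apply: ler_sum => x Dx; apply: mul_ln_le => //.
  - have := ur x Dx; have := u0 x; lra.
  - exact: p0.
  - rewrite uv; have := v0 x; lra.
have hB : \sum_(x | D x) \sum_(y | D y) u x * v y / dlt * (ln b + ln (p y) - ln (r x)) <=
    \sum_(x | D x) \sum_(y | D y) ((if x == y then 0 else b * p y) - u x * v y / dlt).
  apply: ler_sum => x Dx; apply: ler_sum => y Dy.
  have [<-|xy] := eqVneq x y; first by rewrite uvx !mul0r subr0.
  have vd : v y / dlt <= 1.
    have := led y v v0 Dy; rewrite sv => vyd.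
    have [->|dz] := eqVneq dlt 0; first by rewrite invr0 mulr0.
    by rewrite ler_pdivrMr ?mul1r// lt_neqAle eq_sym dz.
  have vd0 : 0 <= v y / dlt by rewrite divr_ge0.
  apply: mul_ln_le => //.
  - rewrite -mulrA mulr_ge0//= (le_trans _ (ur x Dx))// ler_piMr//.
  - exact: p0.
  - move=> h; have : v y != 0 by apply: contraTneq h => ->; rewrite mulr0 mul0r ltxx.
    have := v0 y; have := vp y Dy; rewrite neq_lt; lra.
(* The sums of v ln p and u ln r in [sA] occur with opposite signs in [sB], so adding the two leaves
   only the entropies and the logarithms of the channel. *)
have sA : \sum_(x | D x) (r x - u x) * (ln (1 - eps) + ln (p x) - ln (r x)) =
    (1 - dlt) * ln (1 - eps) + (\sum_(x | D x) p x * ln (p x)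
      - \sum_(x | D x) v x * ln (p x))
      - (\sum_(x | D x) r x * ln (r x) - \sum_(x | D x) u x * ln (r x)).
  have -> : 1 - dlt = \sum_(x | D x) (r x - u x) by rewrite sumrB sr su.
  rewrite mulr_suml -!sumrB -big_split -sumrB/=.
  apply: eq_bigr => x Dx; rewrite -[p x * _ - _]mulrBl -uv; ring.
have row x : D x -> \sum_(y | D y) u x * v y / dlt = u x.
  by move=> Dx; rewrite -mulr_suml -mulr_sumr sv mulrAC udlt.
have sB : \sum_(x | D x) \sum_(y | D y) u x * v y / dlt * (ln b + ln (p y) - ln (r x)) =
    dlt * ln b + \sum_(x | D x) v x * ln (p x) - \sum_(x | D x) u x * ln (r x).
  transitivity (\sum_(x | D x) (u x * ln b - u x * ln (r x)
      + u x * (\sum_(y | D y) v y / dlt * ln (p y)))).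
    apply: eq_bigr => x Dx; rewrite -mulrBr -{2}(row x Dx) mulr_suml mulr_sumr.
    by rewrite -big_split/=; apply: eq_bigr => y Dy; ring.
  rewrite big_split sumrB/= -!mulr_suml su mulr_sumr addrAC; congr (_ + _ - _).
  by apply: eq_bigr => y Dy; rewrite mulrA vdlt.
have tA : \sum_(x | D x) ((1 - eps) * p x - (r x - u x)) = dlt - eps.
  by rewrite !sumrB -mulr_sumr sp sr su; ring.
(* Each [y] has #|D| - 1 other points to move to. As #|D| <= d, this total is at most eps - dlt,
   which cancels [tA]. *)
have tB : \sum_(x | D x) \sum_(y | D y) ((if x == y then 0 else b * p y) - u x * v y / dlt)
    = b * (#|D|%:R - 1) - dlt.
  rewrite (eq_bigr _ (fun x _ => sumrB _ _ _ _)) sumrB (eq_bigr _ row) su exchange_big/=.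
  congr (_ - _).
  transitivity (\sum_(y | D y) b * (#|D|%:R - 1) * p y).
    apply: eq_bigr => y Dy.
    transitivity (\sum_(x | D x) (b * p y - (if x == y then b * p y else 0))).
      by apply: eq_bigr => x _; case: ifP => _; rewrite ?subrr ?subr0.
    rewrite sumrB sumr_const (bigD1 y)//= eqxx big1 ?addr0.
      by rewrite -[_ *+ _]mulr_natr; ring.
    by move=> x /andP[_ /negbTE->].
  by rewrite -mulr_sumr sp mulr1.
have bd : b * (#|D|%:R - 1) <= eps.
  have cD : #|D|%:R <= d%:R :> R by rewrite ler_nat.
  rewrite -[leRHS](@divfK _ (d%:R - 1)); last by rewrite gt_eqF//; lra.
  by rewrite ler_pM2l//; lra.
have etaE (f : T -> R) : \sum_(x | D x) eta (f x) = - \sum_(x | D x) f x * ln (f x).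
  by rewrite sumrN.
have lnb : ln b = ln eps - ln (d%:R - 1) by rewrite ln_div ?posrE//; lra.
have lb : ln b <= ln (1 - eps) by rewrite ler_ln ?posrE.
rewrite !etaE /h2 /eta.
move: hA hB; rewrite sA sB tA tB.
(* The actual moved mass [dlt] may be below [eps]. Replacing it by [eps] weakens the bound because
   [b <= 1 - eps], which is the hypothesis eps <= 1 - 1/d. *)
have : (eps - dlt) * ln b <= (eps - dlt) * ln (1 - eps) by rewrite ler_wpM2l//; lra.
have : eps * ln b = eps * (ln eps - ln (d%:R - 1)) by rewrite lnb.
lra.
Qed.

(** * The entropy inequality for sequences *)

Lemma finite_nat_bound (A : set nat) : finite_set A -> exists n, A `<=` `I_n.
Proof.
move=> fA; exists (\max_(i <- finmap.enum_fset (fset_set A)) i).+1 => i Ai /=; rewrite ltnS.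
by apply: leq_bigmax_seq => //; rewrite in_fset_set// inE.
Qed.

Lemma card_ord_pred_le (A : pred nat) n d : ([set i | A i] #<= `I_d)%card ->
  (#|[pred i : 'I_n | A i]| <= d)%N.
Proof.
move=> Ad; have fA : finite_set [set i | A i] by apply/finite_set_leP; exists d.
apply: leq_trans (geq_card_fset_set Ad); rewrite cardE -(size_map val).
apply: uniq_leq_size; first by rewrite map_inj_uniq ?enum_uniq//; exact: val_inj.
by move=> _ /mapP[i + ->]; rewrite mem_enum in_fset_set// inE.
Qed.

Lemma psum_cond_le1 {R : realType} (p : R^nat) (B : pred nat) n : P1 p ->
  \sum_(0 <= i < n | B i) p i <= 1.
Proof.
move=> hp; apply: le_trans (P1_psum_le1 p n hp); have [p0 _] := hp.
by rewrite big_mkcond; apply: ler_sum => i _; case: ifP.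
Qed.

Lemma big_nat_supp {V : nmodType} (F : nat -> V) (B : pred nat) m n : (n <= m)%N ->
  (forall i, B i -> (i < n)%N) ->
  \sum_(0 <= i < m | B i) F i = \sum_(0 <= i < n | B i) F i.
Proof.
move=> nm Bn; rewrite (big_cat_nat _ nm)//= [X in _ + X]big_nat_cond.
rewrite [X in _ + X]big1 ?addr0// => i /andP[/andP[ni _] /Bn].
by rewrite ltnNge ni.
Qed.

Lemma shannon_ge {R : realType} (p : R^nat) n : P1 p ->
  ((\sum_(0 <= i < n) eta (p i))%:E <= shannon p)%E.
Proof.
move=> hp; rewrite -sumEFin; apply: nneseries_lim_ge => i _.
by rewrite lee_fin eta_ge0// (P1_le1 p)// andbT; case: hp.
Qed.

Lemma shannon_real {R : realType} (p : R^nat) : P1 p -> (shannon p < +oo)%E ->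
  exists H, shannon p = H%:E.
Proof.
move=> hp pfin; exists (fine (shannon p)); rewrite fineK// ge0_fin_numE//.
by have := shannon_ge p 0 hp; rewrite big_geq.
Qed.

(** Each p_i outside [B] is at most the merged mass P, so eta(p_i) >= p_i (- ln P), and these p_i
    sum to P. Hence merging all points outside [B] into one does not raise the entropy. *)
Lemma shannon_lump {R : realType} (p : R^nat) (B : pred nat) n :
  P1 p -> (forall i, B i -> (i < n)%N) ->
  ((\sum_(0 <= i < n | B i) eta (p i) +
    eta (1 - \sum_(0 <= i < n | B i) p i))%:E <= shannon p)%E.
Proof.
move=> hp Bn; have [p0 _] := hp.
set P := 1 - _.
have split_sum (F : nat -> R) m : (n <= m)%N ->
    \sum_(0 <= i < m) F i =
    \sum_(0 <= i < n | B i) F i + \sum_(0 <= i < m | ~~ B i) F i.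
  by move=> nm; rewrite (bigID B)/= (big_nat_supp _ _ _ _ nm).
have pP i : ~~ B i -> p i <= P.
  move=> nBi; have := P1_psum_le1 p (maxn n i.+1) hp.
  rewrite (split_sum _ _ (leq_maxl _ _)).
  have : p i <= \sum_(0 <= j < maxn n i.+1 | ~~ B j) p j.
    rewrite big_mkord (bigD1 (Ordinal (leq_maxr n i.+1)))//= lerDl.
    by apply: sumr_ge0.
  by rewrite /P; lra.
(* For m >= n this minorizes the m-th partial sum of the entropy; the factor of - ln P tends to
   P. *)
pose x m := \sum_(0 <= i < n | B i) eta (p i)
  + (\sum_(0 <= i < m) p i - \sum_(0 <= i < n | B i) p i) * - ln P.
have xc : (x m)%:E @[m --> \oo] -->
    (\sum_(0 <= i < n | B i) eta (p i) + eta P)%:E.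
  apply: cvg_EFin; first exact: nearW.
  rewrite /eta -[- (P * _)]mulrN; apply: cvgD; first exact: cvg_cst.
  apply: cvgM; last exact: cvg_cst.
  by apply: cvgB; [exact: P1_cvg|exact: cvg_cst].
apply: (cvge_to_le xc); exists n => // m /= nm.
apply: le_trans (shannon_ge p m hp); rewrite lee_fin /x !(split_sum _ _ nm).
rewrite addrAC subrr add0r lerD2l mulr_suml; apply: ler_sum => i nBi.
rewrite /eta -mulrN; have [pi0|] := ltP 0 (p i); last first.
  by move=> h; have -> : p i = 0; [have := p0 i; lra|rewrite !mul0r].
rewrite ler_pM2l// lerN2 ler_ln ?posrE ?pP//.
exact: lt_le_trans (pP _ nBi).
Qed.

Lemma P1_supp_nonempty {R : realType} (r : R^nat) : P1 r -> exists a, 0 < r a.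
Proof.
move=> hr; apply: contrapT => h; have [r0 _] := hr.
have : (1 : R) <= 0; last by rewrite ler10.
apply: (cvgr_to_le (P1_cvg r hr)); apply: nearW => n.
apply: sumr_le0 => i _; rewrite leNgt; apply/negP => ri; apply: h; by exists i.
Qed.

Lemma entropy_le_TV {R : realType} (p r : R^nat) (d : nat) (eps : R) n :
  P1 p -> P1 r -> (2 <= d)%N -> 0 < eps <= 1 - d%:R^-1 ->
  (supp r #<= `I_d)%card -> supp r `<=` `I_n -> (TV p r <= eps%:E)%E ->
  ((\sum_(0 <= i < n) eta (r i))%:E <=
    shannon p + (eps * ln (d%:R - 1) + h2 eps)%:E)%E.
Proof.
move=> hp hr d2 epsd rd rn tv.
have [p0 _] := hp; have [r0 _] := hr.
have [a ra] := P1_supp_nonempty r hr.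
pose D i := 0 < r i; pose B i := D i && (i != a).
pose P := 1 - \sum_(0 <= i < n | B i) p i.
(* The point [a] receives its own mass and all mass of [p] outside supp r. Outside supp r, [p']
   keeps the values of [p], but only its values on [D] enter. *)
pose p' i := if i == a then P else p i.
have an : (a < n)%N by exact: rn.
have bigDa (F : nat -> R) : \sum_(0 <= i < n | D i) F i =
    F a + \sum_(0 <= i < n | B i) F i.
  by rewrite !big_mkord (bigD1 (Ordinal an)).
have p'B (F : R -> R) : \sum_(0 <= i < n | B i) F (p' i) =
    \sum_(0 <= i < n | B i) F (p i).
  by apply: eq_bigr => i /andP[_ /negbTE]; rewrite /p' => ->.
have p'a : p' a = P by rewrite /p' eqxx.
have paP : p a <= P.
  by have := psum_cond_le1 p D n hp; rewrite bigDa /P; lra.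
have pp' i : p i <= p' i by rewrite /p'; case: eqP => // ->.
have p'0 i : 0 <= p' i by exact: le_trans (pp' i).
have supr (F : R -> R) : F 0 = 0 ->
    \sum_(0 <= i < n) F (r i) = \sum_(0 <= i < n | D i) F (r i).
  move=> F0; rewrite [RHS]big_mkcond; apply: eq_bigr => i _; case: ifPn => //.
  by rewrite /D -leNgt => h; have -> : r i = 0 by have := r0 i; lra.
have psum1 : \sum_(0 <= i < n | D i) r i = 1.
  apply/eqP; rewrite -(supr id)// eq_le P1_psum_le1//=.
  apply: (cvgr_to_le (P1_cvg r hr)); exists n => // m /= nm.
  rewrite (big_cat_nat _ nm)//= gerDl big_nat big1// => i /andP[ni _].
  apply/eqP; rewrite eq_le r0 andbT leNgt; apply/negP => /rn /=.
  by rewrite ltnNge ni.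
have := @entropy_le_TV_finite R 'I_n [pred i : 'I_n | D i] r p' d eps d2
   (@card_ord_pred_le D n d rd) epsd (fun x Dx => Dx) (fun x _ => p'0 x).
rewrite /= -(big_mkord D r) -(big_mkord D p').
rewrite -(big_mkord D (fun i => eta (r i))) -(big_mkord D (fun i => eta (p' i))).
rewrite -(big_mkord D (fun i => Num.max 0 (r i - p' i))).
rewrite psum1 (bigDa p') (p'B id) p'a subrK => /(_ erefl erefl).
(* As p <= p' pointwise, moving the mass cannot increase the excess of [r]. *)
have -> : \sum_(0 <= i < n | D i) Num.max 0 (r i - p' i) <= eps.
  have tv' : (TV r p <= eps%:E)%E by rewrite TV_sym.
  apply: le_trans (TV_excess r p eps n hr hp tv').
  rewrite big_mkcond; apply: ler_sum => i _; case: ifP => _.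
    by rewrite ge_max !le_max lexx/=; have := pp' i; case: (leP (r i - p' i) 0); lra.
  by rewrite le_max lexx.
move=> /(_ isT) h.
rewrite (supr eta eta0).
apply: le_trans (leeD2r _ (shannon_lump p B n hp _)); last first.
  by move=> i /andP[Di _]; exact: rn.
rewrite -EFinD lee_fin; move: h; rewrite (bigDa (fun i => eta (p' i))) p'a p'B.
by rewrite -/P; lra.
Qed.

(** Used contrapositively in the limits: a real number below the divergence is exceeded by some
    partial sum. *)
Lemma KL_le {R : realType} (p q : R^nat) (x : R^nat) (b : R) :
  P1 p -> P1 q -> supp p `<=` supp q -> x n @[n --> \oo] --> b ->
  (forall n, \sum_(0 <= i < n) p i * ln (p i / q i) <= x n) ->
  (KL p q <= b%:E)%E.
Proof.
move=> hp hq hpq xb hx.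
have xe : (x n)%:E @[n --> \oo] --> b%:E by apply: cvg_EFin; [exact: nearW|].
apply: (lee_cvg_to (KL_cvg p q hp hq hpq) xe).
by apply: nearW => n; rewrite lee_fin.
Qed.

(** * The truncation max(0, p_i - eps) and the bounds as ordinary partial sums *)

Lemma Ieps_bound {R : realType} (p : R^nat) (eps : R) : P1 p -> 0 < eps ->
  \forall n \near \oo, Ieps p eps `<=` `I_n.
Proof.
move=> hp eps0; have [p0 _] := hp.
(* Once a partial sum exceeds 1 - eps, no later entry can exceed [eps]. *)
have lt1 : 1 - eps < 1 by lra.
apply: filterS (cvgr_gt _ (P1_cvg p hp) _ lt1) => n hn i; rewrite /Ieps /= => pi.
rewrite ltnNge; apply/negP => ni.
have := P1_psum_le1 p i.+1 hp; rewrite big_nat_recr//=.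
have := psum_nd p p0 n i ni; rewrite /=; lra.
Qed.

(** Indices outside I_eps truncate to 0, where [G i] vanishes. The sum over a set depending on [eps]
    thus becomes one over a range, suited to termwise comparison and to limits. *)
Lemma Ieps_sum {R : realType} (p : R^nat) (eps : R) (G : nat -> R -> R) n :
  Ieps p eps `<=` `I_n -> (forall i, G i 0 = 0) ->
  \sum_(i \in Ieps p eps) G i (p i - eps) =
  \sum_(0 <= i < n) G i (Num.max 0 (p i - eps)).
Proof.
move=> In G0; rewrite big_mkord (fsbig_ord _ _ (fun i => G i (Num.max 0 (p i - eps)))).
rewrite -(fsbig_widen (Ieps p eps) `I_n)//.
  apply: eq_fsbigr => i /[!inE]; rewrite /Ieps/= => pi.
  by rewrite (max_idPr _)// subr_ge0 ltW.
move=> i [/= _]; rewrite /Ieps/= => /negP; rewrite -leNgt => pi.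
by rewrite (max_idPl _) ?G0// subr_le0.
Qed.

Lemma cepsE {R : realType} (p : R^nat) (eps : R) n : Ieps p eps `<=` `I_n ->
  ceps p eps = \sum_(0 <= i < n) Num.max 0 (p i - eps).
Proof. by move=> In; exact: (Ieps_sum p eps (fun=> id) n). Qed.

Lemma ceps_ge {R : realType} (p : R^nat) (eps : R) n : P1 p -> 0 < eps ->
  \sum_(0 <= i < n) Num.max 0 (p i - eps) <= ceps p eps.
Proof.
move=> hp eps0; have [m _ hm] := Ieps_bound p eps hp eps0.
rewrite (cepsE p eps (maxn m n)); last by apply: hm; exact: leq_maxl.
by apply: psum_nd; [move=> i; rewrite le_max lexx|exact: leq_maxr].
Qed.

Lemma ceps_le1 {R : realType} (p : R^nat) (eps : R) : P1 p -> 0 < eps ->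
  ceps p eps <= 1.
Proof.
move=> hp eps0; have [m _ hm] := Ieps_bound p eps hp eps0; have [p0 _] := hp.
rewrite (cepsE p eps m (hm _ (leqnn m))).
apply: le_trans (P1_psum_le1 p m hp); apply: ler_sum => i _.
by rewrite ge_max p0/=; lra.
Qed.

(** Pulling c out of the logarithm yields - c ln c = eta(c), which cancels against the same term of
    h2(1 - c). *)
Lemma bound_iE {R : realType} (p q : R^nat) (eps : R) n : P1 p -> P1 q ->
  supp p `<=` supp q -> 0 < eps -> Ieps p eps `<=` `I_n ->
  bound_i p q eps =
    \sum_(0 <= i < n) Num.max 0 (p i - eps) * ln (Num.max 0 (p i - eps) / q i)
    - eta (1 - ceps p eps) - g eps - h2t eps.
Proof.
move=> hp hq hpq eps0 In; rewrite /bound_i.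
rewrite (Ieps_sum p eps (fun i x => x * ln (x / (ceps p eps * q i))) n In); last first.
  by move=> i; rewrite mul0r.
have sc i : Num.max 0 (p i - eps) <= ceps p eps.
  apply: le_trans (ceps_ge p eps i.+1 hp eps0); rewrite big_nat_recr//= lerDr.
  by apply: sumr_ge0 => j _; rewrite le_max lexx.
have -> : \sum_(0 <= i < n) Num.max 0 (p i - eps) *
      ln (Num.max 0 (p i - eps) / (ceps p eps * q i)) =
    \sum_(0 <= i < n) Num.max 0 (p i - eps) * ln (Num.max 0 (p i - eps) / q i)
    + eta (ceps p eps).
  rewrite /eta -mulNr {2}(cepsE p eps n In) -sumrN mulr_suml -big_split/=.
  apply: eq_bigr => i _; have := sc i; set s := Num.max 0 _ => sci.
  have [s0|] := ltP 0 s; last first.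
    have : 0 <= s by rewrite le_max lexx.
    by move=> s0 s0'; have -> : s = 0; [lra|rewrite !mul0r oppr0 mul0r addr0].
  have qi : 0 < q i.
    by apply: hpq; move: s0; rewrite /supp/= /s lt_max ltxx/=; lra.
  have c0 : 0 < ceps p eps by exact: lt_le_trans sci.
  rewrite !ln_div ?posrE ?mulr_gt0// lnM ?posrE//; ring.
have c1 : 1 - (1 - ceps p eps) = ceps p eps by ring.
by rewrite /h2 c1; ring.
Qed.

Lemma bound_iiE {R : realType} (d : nat) (p q : R^nat) (eps H : R) n :
  shannon p = H%:E -> Ieps p eps `<=` `I_n ->
  bound_ii d p q eps =
    (\sum_(0 <= i < n) - ln (q i) * Num.max 0 (p i - eps)
     - H - eps * ln (d%:R - 1) - h2 eps)%:E.
Proof.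
move=> pH In; rewrite /bound_ii pH.
by rewrite (Ieps_sum p eps (fun i x => - ln (q i) * x) n In)// => i; rewrite mulr0.
Qed.

Lemma TV_ge_max {R : realType} (p r : R^nat) eps i : P1 p -> P1 r ->
  (TV p r <= eps%:E)%E -> Num.max 0 (p i - eps) <= r i.
Proof.
move=> hp hr tv; rewrite ge_max (TV_ge p r eps i hp hr tv) andbT.
by have [+ _] := hr.
Qed.

(** * The two lower bounds for a fixed competitor *)

Lemma bound_i_le_KL {R : realType} (p q r : R^nat) (eps : R) :
  P1 p -> P1 q -> P1 r -> supp p `<=` supp q -> 0 < eps <= 1 ->
  (TV p r <= eps%:E)%E -> ((bound_i p q eps)%:E <= KL r q)%E.
Proof.
move=> hp hq hr hpq /andP[eps0 eps1] tv.
have [hrq|/asboolPn hrq] := pselect (supp r `<=` supp q); last first.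
  by rewrite /KL (negbTE hrq) leey.
have [p0 _] := hp; have [q0 _] := hq; have [r0 _] := hr.
have [m _ hm] := Ieps_bound p eps hp eps0.
pose s i := Num.max 0 (p i - eps); pose c := ceps p eps.
have s0 i : 0 <= s i by rewrite le_max lexx.
have sr i : s i <= r i by exact: TV_ge_max.
have c1 : 0 <= 1 - c by rewrite subr_ge0 ceps_le1.
have cE n : (m <= n)%N -> \sum_(0 <= i < n) s i = c.
  by move=> mn; rewrite -(cepsE p eps n)//; exact: hm.
(* A single term of the nonnegative remainder r - s is at most its total mass; this allows T = 1 - c
   in [mul_ln_split]. *)
have rsT i : r i - s i <= 1 - c.
  rewrite -(cE (maxn m i.+1)) ?leq_maxl//.
  apply: (@le_trans _ _ (\sum_(0 <= j < maxn m i.+1) (r j - s j))).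
    rewrite big_mkord (bigD1 (Ordinal (leq_maxr m i.+1)))//= lerDl.
    by apply: sumr_ge0 => j _; rewrite subr_ge0.
  by rewrite sumrB lerB// P1_psum_le1.
pose S := \sum_(0 <= i < m) s i * ln (s i / q i).
apply: (@le_trans _ _ (S - eta (1 - c))%:E).
  rewrite (bound_iE p q eps m)// ?lee_fin; last exact: hm (leqnn m).
  have e01 : 0 <= eps <= 1 by lra.
  have := g_ge0 eps e01; have := h2t_ge0 eps e01; rewrite /S/s/c; lra.
(* The summed bounds of [mul_ln_split] with T = 1 - c; in the limit the two linear parts cancel. *)
pose x n := S + (\sum_(0 <= i < n) r i - c) * ln (1 - c)
  + (\sum_(0 <= i < n) r i - c) - (1 - c) * \sum_(0 <= i < n) q i.
apply: (@KL_ge _ r q x) => //.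
  have -> : S - eta (1 - c) = S + (1 - c) * ln (1 - c) + (1 - c) - (1 - c) * 1.
    by rewrite /eta; ring.
  have rc : \sum_(0 <= i < n) r i - c @[n --> \oo] --> 1 - c.
    by apply: cvgB; [exact: P1_cvg|exact: cvg_cst].
  apply: cvgB; last by apply: cvgM; [exact: cvg_cst|exact: P1_cvg].
  apply: cvgD; last exact: rc.
  apply: cvgD; first exact: cvg_cst.
  by apply: cvgM; [exact: rc|exact: cvg_cst].
exists m => // n /= mn; rewrite /x -(cE n mn) -sumrB.
have -> : S = \sum_(0 <= i < n) s i * ln (s i / q i).
  rewrite /S [RHS](big_cat_nat _ mn)//= -[LHS]addr0; congr (_ + _).
  rewrite big_nat big1// => i /andP[mi _]; suff -> : s i = 0 by rewrite mul0r.
  rewrite /s (max_idPl _)// subr_le0 leNgt; apply/negP => /(hm m (leqnn m)) /=.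
  by rewrite ltnNge mi.
rewrite mulr_suml mulr_sumr -!big_split -sumrB/= (cE n mn).
apply: ler_sum => i _.
have rE : r i = s i + (r i - s i) by ring.
rewrite [in leRHS]rE; apply: mul_ln_split => //.
- by rewrite subr_ge0.
- by rewrite -rE => /hrq.
- by move=> h; exact: lt_le_trans (rsT i).
Qed.

Lemma Ieps_psum_eq {R : realType} (p : R^nat) (eps : R) (G : nat -> R -> R) m n :
  Ieps p eps `<=` `I_m -> Ieps p eps `<=` `I_n -> (forall i, G i 0 = 0) ->
  \sum_(0 <= i < m) G i (Num.max 0 (p i - eps)) =
  \sum_(0 <= i < n) G i (Num.max 0 (p i - eps)).
Proof. by move=> Im In G0; rewrite -(Ieps_sum p eps G m)// (Ieps_sum p eps G n). Qed.

Lemma bound_ii_le_KL {R : realType} (d : nat) (p q r : R^nat) (eps : R) :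
  P1 p -> P1 q -> P1 r -> (shannon p < +oo)%E -> (2 <= d)%N ->
  0 < eps <= 1 - d%:R^-1 -> (supp r #<= `I_d)%card -> (TV p r <= eps%:E)%E ->
  (bound_ii d p q eps <= KL r q)%E.
Proof.
move=> hp hq hr pfin d2 heps rd tv.
have [hrq|/asboolPn hrq] := pselect (supp r `<=` supp q); last first.
  by rewrite /KL (negbTE hrq) leey.
have [q0 _] := hq; have [r0 _] := hr.
have eps0 : 0 < eps by have /andP[] := heps.
have [H pH] := shannon_real p hp pfin.
have [n rn] : exists n, supp r `<=` `I_n.
  by apply: finite_nat_bound; apply/finite_set_leP; exists d.
(* An entry p_i > eps forces r_i > 0, so one range covers both supp r and I_eps. *)
have Ir : Ieps p eps `<=` supp r.
  move=> i; rewrite /Ieps/supp/= => pi; have := TV_ge p r eps i hp hr tv; lra.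
rewrite (bound_iiE d p q eps H n pH); last exact: subset_trans rn.
apply: KL_ge => //; first exact: cvg_cst.
exists n => // m /= nm.
have rm : supp r `<=` `I_m.
  by apply: subset_trans rn _ => i /= /leq_trans; exact.
have := entropy_le_TV p r d eps m hp hr d2 heps rd rm tv.
rewrite pH -EFinD lee_fin => hH.
have -> : \sum_(0 <= i < n) - ln (q i) * Num.max 0 (p i - eps) =
    \sum_(0 <= i < m) - ln (q i) * Num.max 0 (p i - eps).
  apply: (Ieps_psum_eq p eps (fun i x => - ln (q i) * x)).
  - exact: subset_trans Ir rn.
  - exact: subset_trans Ir rm.
  - by move=> i; rewrite mulr0.
suff : \sum_(0 <= i < m) (- ln (q i) * Num.max 0 (p i - eps) - eta (r i)) <=
    \sum_(0 <= i < m) r i * ln (r i / q i) by rewrite sumrB; lra.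
apply: ler_sum => i _; rewrite mul_ln_divE//; last exact: hrq.
(* The weight - ln q_i is nonnegative since q_i <= 1. *)
have : - ln (q i) * Num.max 0 (p i - eps) <= - ln (q i) * r i.
  by rewrite ler_wpM2l ?TV_ge_max// oppr_ge0 ln_le0// P1_le1.
lra.
Qed.

(** The support of [p] may be infinite, so [bound_ii_le_KL] cannot be used with r = p. Here the
    partial entropies of [p] are bounded directly by its entropy. *)
Lemma bound_ii_le_KL_self {R : realType} (d : nat) (p q : R^nat) (eps : R) :
  P1 p -> P1 q -> supp p `<=` supp q -> (shannon p < +oo)%E -> (2 <= d)%N ->
  0 < eps <= 1 -> (bound_ii d p q eps <= KL p q)%E.
Proof.
move=> hp hq hpq pfin d2 /andP[eps0 eps1].
have [p0 _] := hp; have [q0 _] := hq.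
have [H pH] := shannon_real p hp pfin.
have [n _ hn] := Ieps_bound p eps hp eps0.
rewrite (bound_iiE d p q eps H n pH (hn n (leqnn n))).
apply: KL_ge => //; first exact: cvg_cst.
exists n => // m /= nm.
have -> : \sum_(0 <= i < n) - ln (q i) * Num.max 0 (p i - eps) =
    \sum_(0 <= i < m) - ln (q i) * Num.max 0 (p i - eps).
  apply: (Ieps_psum_eq p eps (fun i x => - ln (q i) * x)).
  - exact: hn (leqnn n).
  - exact: hn nm.
  - by move=> i; rewrite mulr0.
have := shannon_ge p m hp; rewrite pH lee_fin => hH.
have hd : 0 <= eps * ln (d%:R - 1).
  rewrite mulr_ge0 ?ln_ge0//; first exact: ltW.
  have : 2 <= d%:R :> R by rewrite (ler_nat R 2 d).
  lra.
have hh : 0 <= h2 eps by apply: h2_ge0; lra.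
suff : \sum_(0 <= i < m) (- ln (q i) * Num.max 0 (p i - eps) - eta (p i)) <=
    \sum_(0 <= i < m) p i * ln (p i / q i) by rewrite sumrB; lra.
apply: ler_sum => i _; rewrite mul_ln_divE//; last exact: hpq.
have : - ln (q i) * Num.max 0 (p i - eps) <= - ln (q i) * p i.
  rewrite ler_wpM2l ?oppr_ge0 ?ln_le0 ?P1_le1//.
  by rewrite ge_max p0; lra.
lra.
Qed.

(** * Limits of the bounds as eps tends to 0 from the right *)

Lemma cvge_squeeze_lt {R : realType} {T : Type} {F : set_system T}
    {FF : Filter F} (f : T -> \bar R) (l : \bar R) : (0 <= l)%E ->
  (\forall x \near F, (f x <= l)%E) ->
  (forall M : R, (M%:E < l)%E -> \forall x \near F, (M%:E <= f x)%E) ->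
  f x @[x --> F] --> l.
Proof.
case: l => [l| |]// _ fl lf; last first.
  by apply/cvgeyPge => M; apply: lf; rewrite ltry.
have ffin : \forall x \near F, f x \is a fin_num.
  (* Lying between l - 1 and l makes [f] finite, which reduces the claim to real convergence. *)
  have : ((l - 1)%:E < l%:E)%E by rewrite lte_fin; lra.
  move=> /lf; apply: filterS2 fl => x; case: (f x) => //.
apply/fine_cvgP; split => //; apply/cvgrPdist_le => e e0.
have : ((l - e)%:E < l%:E)%E by rewrite lte_fin; lra.
move=> /lf; apply: filterS3 fl ffin => x /=; case: (f x) => //= y.
by rewrite !lee_fin => yl _ ly; rewrite ger0_norm; lra.
Qed.

Lemma near_unit {R : realType} : \forall eps \near (0 : R)^'+, 0 < eps <= 1.
Proof.
near=> eps; apply/andP; split; first by near: eps; exact: nbhs_right_gt.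
by near: eps; apply: nbhs_right_le; lra.
Unshelve. all: by end_near. Qed.

Lemma max_sub_cvg {R : realType} (a : R) : 0 <= a ->
  Num.max 0 (a - eps) @[eps --> 0^'+] --> a.
Proof.
move=> a0; apply: (@squeeze_cvgr _ _ _ _ (fun eps => a - eps) (fun=> a)).
- near=> eps; have : 0 < eps by near: eps; exact: nbhs_right_gt.
  by rewrite le_max lexx orbT/= ge_max a0/=; lra.
- rewrite -[X in _ --> X]subr0; apply: cvgB; first exact: cvg_cst.
  exact: cvg_at_right_filter.
- exact: cvg_cst.
Unshelve. all: by end_near. Qed.

Lemma eta_cvg {R : realType} (T : Type) (F : set_system T) {FF : Filter F}
    (f : T -> R) (a : R) : 0 <= a -> f x @[x --> F] --> a ->
  eta (f x) @[x --> F] --> eta a.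
Proof. by move=> a0 fa; exact: (cvg_comp _ _ fa (continuous_eta a a0)). Qed.

Lemma h2_cvg0 {R : realType} : h2 eps @[eps --> (0 : R)^'+] --> (0 : R).
Proof.
have id0 : eps @[eps --> (0 : R)^'+] --> (0 : R) by exact: cvg_at_right_filter.
suff : h2 eps @[eps --> (0 : R)^'+] --> eta (0 : R) + eta (1 - 0 : R).
  by rewrite subr0 eta0 eta1 addr0.
apply: cvgD; first by apply: eta_cvg; [|exact: id0].
by apply: eta_cvg; [rewrite subr0|apply: cvgB; [exact: cvg_cst|exact: id0]].
Qed.

Lemma h2t_cvg0 {R : realType} : h2t eps @[eps --> (0 : R)^'+] --> (0 : R).
Proof.
apply: cvg_trans (@h2_cvg0 R); apply: near_eq_cvg; near=> eps.
rewrite /h2t ifT//; near: eps; apply: nbhs_right_le; lra.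
Unshelve. all: by end_near. Qed.

Lemma g_cvg0 {R : realType} : g eps @[eps --> (0 : R)^'+] --> (0 : R).
Proof.
have id0 : eps @[eps --> (0 : R)^'+] --> (0 : R) by exact: cvg_at_right_filter.
rewrite (_ : g = fun eps : R => eta eps - eta (eps + 1)); last first.
  by apply/funext => e; rewrite /g /eta; ring.
suff : eta eps - eta (eps + 1) @[eps --> (0 : R)^'+] --> eta (0 : R) - eta (0 + 1 : R).
  by rewrite add0r eta0 eta1 subr0.
apply: cvgB; first by apply: eta_cvg; [|exact: id0].
by apply: eta_cvg; [rewrite add0r|apply: cvgD; [exact: id0|exact: cvg_cst]].
Qed.

Lemma psum_max_cvg {R : realType} (p : R^nat) (G : nat -> R -> R) n :
  (forall i, G i (Num.max 0 (p i - eps)) @[eps --> 0^'+] --> G i (p i)) ->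
  \sum_(0 <= i < n) G i (Num.max 0 (p i - eps)) @[eps --> 0^'+] -->
  \sum_(0 <= i < n) G i (p i).
Proof.
by move=> hG; apply: cvg_big => [|i _]; [exact: add_continuous|exact: hG].
Qed.

(** A finite partial sum of [p] is already close to 1; its truncation converges to it and stays
    below c_eps <= 1. *)
Lemma ceps_cvg {R : realType} (p : R^nat) : P1 p ->
  ceps p eps @[eps --> 0^'+] --> (1 : R).
Proof.
move=> hp; have [p0 _] := hp; apply/cvgrPdist_le => e e0.
have lt1 : 1 - e < 1 by lra.
have [n _ hn] := cvgr_gt _ (P1_cvg p hp) _ lt1.
have hs := psum_max_cvg p (fun=> id) n (fun i => max_sub_cvg (p i) (p0 i)).
have hgt := cvgr_gt _ hs _ (hn n (leqnn n)).
apply: filterS2 (@near_unit R) (hgt _) => eps /andP[eps0 _] h.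
have := ceps_le1 p eps hp eps0; have := ceps_ge p eps n hp eps0 => ? ?.
rewrite ger0_norm; lra.
Qed.

Lemma bound_i_cvg {R : realType} (p q : R^nat) : P1 p -> P1 q ->
  supp p `<=` supp q -> (bound_i p q eps)%:E @[eps --> 0^'+] --> KL p q.
Proof.
move=> hp hq hpq; have [p0 _] := hp; have [q0 _] := hq.
apply: cvge_squeeze_lt; first exact: KL_ge0.
  apply: filterS (@near_unit R) => eps heps; apply: bound_i_le_KL => //.
  rewrite /TV eseries0 ?mule0 ?lee_fin; first by lra.
  by move=> i _ _; rewrite subrr normr0.
move=> M MKL.
(* The terms are corrected by p_i - q_i to be nonnegative, so that a finite range gives a lower
   bound; the correction sums to 0. *)
have [N MN] : exists N, M < \sum_(0 <= i < N) (p i * ln (p i / q i) - (p i - q i)).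
  apply: contrapT => h; move: MKL; apply/negP; rewrite -leNgt.
  apply: (KL_le _ _ (fun n => M + \sum_(0 <= i < n) (p i - q i))) => //.
    by rewrite -[X in _ --> X]addr0; apply: cvgD; [exact: cvg_cst|exact: P1B_cvg].
  move=> n; have : ~ (M < \sum_(0 <= i < n) (p i * ln (p i / q i) - (p i - q i))).
    by move=> Mn; apply: h; exists n.
  by move/negP; rewrite -leNgt sumrB; lra.
pose G i x := x * ln (x / q i) - (x - q i).
pose s eps i := Num.max 0 (p i - eps).
(* A minorant of the bound with the fixed range [N]: extending the range to [n] adds nonnegative
   terms, and the linear parts sum to c_eps - sum q_i >= c_eps - 1. *)
pose phi eps := \sum_(0 <= i < N) G i (s eps i) + ceps p eps - 1
  - eta (1 - ceps p eps) - g eps - h2t eps.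
have sq eps i : 0 < eps -> 0 < s eps i -> 0 < q i.
  by move=> e0; rewrite /s lt_max ltxx/= => h; apply: hpq; rewrite /supp/=; lra.
have s0 eps i : 0 <= s eps i by rewrite le_max lexx.
have phic : phi eps @[eps --> 0^'+] --> \sum_(0 <= i < N) G i (p i).
  have cc := ceps_cvg p hp.
  have -> : \sum_(0 <= i < N) G i (p i) =
      \sum_(0 <= i < N) G i (p i) + 1 - 1 - eta (1 - 1) - 0 - 0.
    by rewrite [1 - 1]subrr eta0; ring.
  apply: cvgB; last exact: h2t_cvg0.
  apply: cvgB; last exact: g_cvg0.
  apply: cvgB; last first.
    by apply: eta_cvg; [lra|apply: cvgB; [exact: cvg_cst|exact: cc]].
  apply: cvgB; last exact: cvg_cst.
  apply: cvgD; last exact: cc.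
  apply: psum_max_cvg => // i; have sc := max_sub_cvg (p i) (p0 i).
  (* Written through [eta], the term is visibly continuous even where p_i = 0. *)
  rewrite /G mul_ln_divE//; last exact: hpq.
  have hc : - eta (s eps i) - s eps i * ln (q i) - (s eps i - q i) @[eps --> 0^'+] -->
      - eta (p i) - p i * ln (q i) - (p i - q i).
    apply: cvgB; last by apply: cvgB; [exact: sc|exact: cvg_cst].
    apply: cvgB; last by apply: cvgM; [exact: sc|exact: cvg_cst].
    by apply: cvgN; apply: eta_cvg; [exact: p0|exact: sc].
  apply: cvg_trans hc; apply: near_eq_cvg; apply: filterS (@near_unit R) => eps /andP[e0 _].
  by rewrite mul_ln_divE ?s0//; exact: sq e0.
have hgt := cvgr_gt _ phic _ MN.
apply: filterS2 (@near_unit R) (hgt _) => eps /andP[e0 e1] Mphi.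
rewrite lee_fin; apply: le_trans (ltW Mphi) _.
have [m _ hm] := Ieps_bound p eps hp e0.
pose n := maxn m N; have In : Ieps p eps `<=` `I_n by apply: hm; exact: leq_maxl.
rewrite (bound_iE p q eps n)// /phi !lerD2r.
have G0 i : 0 <= G i (s eps i).
  by rewrite subr_ge0; apply: mul_ln_ge => //; exact: sq.
have sumG : \sum_(0 <= i < n) G i (s eps i) =
    \sum_(0 <= i < n) s eps i * ln (s eps i / q i)
    - (ceps p eps - \sum_(0 <= i < n) q i).
  by rewrite (cepsE p eps n In) -!sumrB.
have := psum_nd _ G0 N n (leq_maxr _ _); rewrite /= sumG /s.
have := P1_psum_le1 q n hq; lra.
Qed.

Lemma shannon_cvg {R : realType} (p : R^nat) (H : R) : P1 p -> shannon p = H%:E ->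
  \sum_(0 <= i < n) eta (p i) @[n --> \oo] --> H.
Proof.
move=> hp pH.
have : (\sum_(0 <= i < n) eta (p i))%:E @[n --> \oo] --> H%:E.
  rewrite -pH; have : cvgn (fun n => \sum_(0 <= i < n) (eta (p i))%:E)%E.
    apply: is_cvg_nneseries => n _ _; rewrite lee_fin eta_ge0// P1_le1// andbT.
    by case: hp.
  move=> hc; apply: cvg_trans hc; apply: near_eq_cvg; apply: nearW => n.
  by rewrite sumEFin.
by move=> /fine_cvgP[_]; apply: cvg_trans.
Qed.

Lemma bound_ii_cvg {R : realType} (d : nat) (p q : R^nat) : P1 p -> P1 q ->
  supp p `<=` supp q -> (shannon p < +oo)%E -> (2 <= d)%N ->
  bound_ii d p q eps @[eps --> 0^'+] --> KL p q.
Proof.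
move=> hp hq hpq pfin d2; have [p0 _] := hp; have [q0 _] := hq.
have [H pH] := shannon_real p hp pfin.
apply: cvge_squeeze_lt; first exact: KL_ge0.
  by apply: filterS (@near_unit R) => eps heps; exact: bound_ii_le_KL_self.
move=> M MKL.
(* The entropy is finite, so the divergence splits as the sum of (- ln q_i) p_i minus [H], with
   nonnegative terms in the sum. *)
have [N MN] : exists N, M < \sum_(0 <= i < N) - ln (q i) * p i - H.
  apply: contrapT => h; move: MKL; apply/negP; rewrite -leNgt.
  apply: (KL_le _ _ (fun n => M + H - \sum_(0 <= i < n) eta (p i))) => //.
    rewrite -[X in _ --> X](addrK H M); apply: cvgB; first exact: cvg_cst.
    exact: shannon_cvg.
  move=> n; have : ~ (M < \sum_(0 <= i < n) - ln (q i) * p i - H).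
    by move=> Mn; apply: h; exists n.
  move/negP; rewrite -leNgt => h'.
  suff -> : \sum_(0 <= i < n) p i * ln (p i / q i) =
    \sum_(0 <= i < n) - ln (q i) * p i + \sum_(0 <= i < n) - eta (p i).
    by rewrite sumrN; lra.
  rewrite -big_split/=; apply: eq_bigr => i _.
  by rewrite mul_ln_divE//; [ring|exact: hpq].
pose phi eps := \sum_(0 <= i < N) - ln (q i) * Num.max 0 (p i - eps) - H
  - eps * ln (d%:R - 1) - h2 eps.
have phic : phi eps @[eps --> 0^'+] --> \sum_(0 <= i < N) - ln (q i) * p i - H.
  rewrite -[X in _ --> X]subr0 -[X in _ --> X - _]subr0.
  apply: cvgB; last exact: h2_cvg0.
  apply: cvgB; last first.
    rewrite -[X in _ --> X](mul0r (ln (d%:R - 1))); apply: cvgM; last exact: cvg_cst.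
    exact: cvg_at_right_filter.
  apply: cvgB; last exact: cvg_cst.
  apply: (psum_max_cvg p (fun i x => - ln (q i) * x)) => // i.
  by apply: cvgM; [exact: cvg_cst|exact: max_sub_cvg].
have hgt := cvgr_gt _ phic _ MN.
apply: filterS2 (@near_unit R) (hgt _) => eps /andP[e0 e1] Mphi.
have [m _ hm] := Ieps_bound p eps hp e0.
pose n := maxn m N; have In : Ieps p eps `<=` `I_n by apply: hm; exact: leq_maxl.
rewrite (bound_iiE d p q eps H n pH In) lee_fin; apply: le_trans (ltW Mphi) _.
rewrite /phi !lerD2r.
(* Nonnegativity lets the range grow from [N] to one containing I_eps. *)
have G0 i : 0 <= - ln (q i) * Num.max 0 (p i - eps).
  by rewrite mulr_ge0 ?le_max ?lexx// oppr_ge0 ln_le0// P1_le1.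
exact: (psum_nd _ G0 N n (leq_maxr _ _)).
Qed.

Theorem proposition8 (R : realType) (p q : R^nat)
    (hp : P1 p) (hq : P1 q) (hpq : supp p `<=` supp q) :
  (forall eps : R, 0 < eps <= 1 ->
     ((bound_i p q eps)%:E <= L_KL q p eps)%E) /\
  ((shannon p < +oo)%E -> forall d : nat, (2 <= d)%N ->
     forall eps : R, 0 < eps <= 1 - d%:R^-1 ->
     (bound_ii d p q eps <= Ld_KL d q p eps)%E) /\
  ((bound_i p q eps)%:E @[eps --> 0^'+] --> KL p q) /\
  ((shannon p < +oo)%E -> forall d : nat, (2 <= d)%N ->
     bound_ii d p q eps @[eps --> 0^'+] --> KL p q).
Proof.
split=> [eps heps|].
  by apply: le_ereal_inf_tmp => _ [r [hr tv] <-]; exact: bound_i_le_KL.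
split=> [pfin d d2 eps heps|].
  by apply: le_ereal_inf_tmp => _ [r [hr rd tv] <-]; exact: bound_ii_le_KL.
by split=> [|pfin d d2]; [exact: bound_i_cvg|exact: bound_ii_cvg].
Qed.
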